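(* For $k=1,2,\dots$ let $f_{\pm k}(x)=x\pm e^{e^k}$ and $p_{\pm k}=\frac12\left(\frac1k-\frac1{k+1}\right)$, and let $\mu$ be the probability measure on $\mathrm{Homeo}_+(\mathbb{R})$ with $\mu(\{f_{\pm k}\})=p_{\pm k}$. Then for every $x\in\mathbb{R}$ and every compact interval $J\subset\mathbb{R}$, almost surely $F_n(x)\in J$ for only finitely many $n$. The same conclusion holds if each $f_{\pm k}$ is replaced by a map $\tilde f_{\pm k}:\mathbb{R}\to\mathbb{R}$ (chosen with the same probability $p_{\pm k}$) such that $\sup_{k}\sup_{x\in\mathbb{R}}|\tilde f_{\pm k}(x)-f_{\pm k}(x)|<\infty$.
   Context: Given the maps and probabilities, let $g_1,g_2,\dots$ be i.i.d. random maps, with $g_n$ equal to the map indexed by $\pm k$ with probability $p_{\pm k}$, and $F_n=g_n\circ\cdots\circ g_1$. *)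

(* Defs.v *)
From HB Require Import structures.
From mathcomp Require Import all_boot all_order all_algebra.
From mathcomp Require Import all_classical all_reals all_analysis.
Set Implicit Arguments. Unset Strict Implicit. Unset Printing Implicit Defensive.
Import Order.TTheory GRing.Theory Num.Theory.
Local Open Scope classical_set_scope.
Local Open Scope ring_scope.

(* Index convention: the pair (k, s) : nat * bool stands for the index
   +(k+1) if s = true and -(k+1) if s = false. *)
Definition idx := (nat * bool)%type.

Definition fstep (R : realType) (i : idx) (x : R) : R :=
  let k := (i.1.+1)%:R in
  if i.2 then x + expR (expR k) else x - expR (expR k).

Definition pk (R : realType) (i : idx) : R :=
  2^-1 * ((i.1.+1)%:R^-1 - (i.1.+2)%:R^-1).

Definition iid_law (R : realType) (d : measure_display) (T : measurableType d)
  (P : probability T R) (xi : nat -> T -> idx) : Prop :=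
  forall (s : seq nat) (v : nat -> idx), uniq s ->
    measurable [set w | all (fun n => xi n w == v n) s] /\
    P [set w | all (fun n => xi n w == v n) s] = (\prod_(n <- s) pk R (v n))%:E.

(* F_n = g_n o ... o g_1, where g_{m+1} is the map indexed by xi m *)
Fixpoint Fiter (R : realType) (g : idx -> R -> R) (xs : nat -> idx) (n : nat)
  (x : R) : R :=
  match n with
  | 0 => x
  | m.+1 => g (xs m) (Fiter g xs m x)
  end.

(* Main.v *)
Require Import Defs.
From HB Require Import structures.
From mathcomp Require Import all_boot all_order all_algebra.
From mathcomp Require Import all_classical all_reals all_analysis.
From mathcomp Require Import zify ring lra.
Import Order.TTheory GRing.Theory Num.Theory.
Local Open Scope classical_set_scope.
Local Open Scope ring_scope.

(** For [2^s <= n < 2^(s+1)], group the first [n] steps by their level [k].  If some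
    level [>= s] has a nonzero net number of signed steps, the highest such level
    contributes at least [e^(e^k)], which dwarfs all lower levels and the accumulated
    bounded errors, so [F_n(x)] leaves any fixed compact set once [s] is large.  Hence a
    return to [J] at time [n] forces every level in the window [[s, 5s)] to be used an
    even number of times.  Expanding the parity indicator in characters, this event has
    probability [2^(-4s) sum_e (1 - 2 sum_j e_j r_j)^n], where [e] ranges over the 0/1
    vectors on the window and [r_j] is the probability of level [j]; as [n r_j >= 1], it
    is at most [(2/3)^(4s)].  Summing over the [2^s] values of [n] gives at most [2^(-s)],
    and Borel-Cantelli concludes. *)

(** * Net signed step counts by level *)

Definition level_sum (xs : nat -> idx) (n m : nat) : int :=
  \sum_(i < n | (xs i).1 == m) (-1) ^+ (~~ (xs i).2).

(** The count minus the signed count is twice the number of negative steps, so the two have the same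
    parity. *)
Lemma odd_level_sum_neq0 (xs : nat -> idx) (n m : nat) :
  odd (\sum_(i < n) ((xs i).1 == m)) -> level_sum xs n m != 0.
Proof.
move=> oddN; apply/eqP => S0.
have : level_sum xs n m = (\sum_(i < n) ((xs i).1 == m))%N%:Z
    - (2 * \sum_(i < n) (((xs i).1 == m) && ~~ (xs i).2))%N%:Z.
  rewrite /level_sum big_mkcond big_distrr/= !(big_morph Posz PoszD erefl) -sumrB.
  by apply: eq_bigr => i _; case: eqP => _; case: (xs i).2.
by rewrite S0; lia.
Qed.

Lemma norm_level_sum_le (xs : nat -> idx) (n m : nat) :
  `|level_sum xs n m| <= n%:Z.
Proof.
apply: le_trans (ler_norm_sum _ _ _) _.
rewrite big_mkcond -[n in n%:Z]card_ord -sum1_card (big_morph Posz PoszD erefl).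
by apply: ler_sum => i _; case: ifP => // _; rewrite normrX normrN normr1 expr1n.
Qed.

(** * Deterministic escape driven by the highest unbalanced level *)

Section Levels.
Context {R : realType}.

(** Stored levels start at 0: [m] stands for k = m + 1. *)
Definition amp (m : nat) : R := expR (expR m.+1%:R).

Lemma amp_ge1 m : 1 <= amp m.
Proof. by apply: le_trans (expR_ge1Dx _); rewrite lerDl expR_ge0. Qed.

Lemma amp_homo m n : (m <= n)%N -> amp m <= amp n.
Proof. by move=> mn; rewrite !ler_expR ler_nat. Qed.

Lemma sum_steps_by_level (xs : nat -> idx) (n U : nat) :
  (forall i, (i < n)%N -> ((xs i).1 < U)%N) ->
  \sum_(i < n) (-1) ^+ (~~ (xs i).2) * amp (xs i).1
  = \sum_(0 <= m < U) amp m * (level_sum xs n m)%:~R.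
Proof.
case: U => [|U] xsU.
  rewrite big_nil big1// => i _.
  by have := xsU i (ltn_ord i); rewrite ltn0.
rewrite big_mkord.
(* All levels lie below the bound, so [inord] loses nothing and the steps are grouped over a finite
   type. *)
rewrite (partition_big (fun i : 'I_n => inord (xs i).1 : 'I_U.+1) xpredT)//=.
apply: eq_bigr => m _.
have Em (i : 'I_n) : (inord (xs i).1 == m :> 'I_U.+1) = ((xs i).1 == m :> nat).
  by rewrite -val_eqE/= inordK// xsU.
under eq_bigl do rewrite Em.
rewrite /level_sum rmorph_sum/= mulr_sumr; apply: eq_bigr => i /eqP ->.
by rewrite mulrC; case: (xs i).2; rewrite /= ?expr0 ?expr1 ?rmorphN ?rmorph1.
Qed.

(* With [y = e^M], [amp M >= e^(2y)] while [amp M.-1 = e^y], and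
   [e^y >= 1 + y^3/6] beats the factor [2^(M+1) (M + 3D) <= 4 y^2]. *)
Lemma amp_dominates (D : R) (M : nat) : 0 <= D -> 3 * D <= M%:R -> (24 <= M)%N ->
  2 ^+ M.+1 * (M%:R * amp M.-1 + 3 * D) < amp M.
Proof.
move=> D0 DM M24.
have M24' : 24 <= M%:R :> R by rewrite ler_nat.
set y : R := expR M%:R.
have yM : M%:R <= y by apply: le_trans (expR_ge1Dx _); rewrite lerDr.
have e2 : (2 : R) <= expR 1 by have := expR_ge1Dx (1 : R); lra.
have pow2 : 2 ^+ M.+1 <= 2 * y.
  rewrite exprS ler_wpM2l// /y -[M%:R]mul1r expRM_natr.
  by apply: lerXn2r; rewrite ?nnegrE ?expR_ge0.
have ampM : expR y ^+ 2 <= amp M.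
  rewrite /amp -expRM_natr ler_expR mulr_natr -[M.+1]addn1 natrD expRD -/y mulr2n.
  by nra.
have ampM1 : amp M.-1 = expR y by rewrite /amp prednK// (leq_trans _ M24).
have eY : 4 * y ^+ 2 < expR y.
  have := @expR_ge1Dxn R y 2 (le_trans (ler0n _ _) yM).
  by rewrite (_ : 3`!%:R = 6)//; nra.
have Z1 : 1 <= expR y by rewrite -ampM1 amp_ge1.
rewrite ampM1; apply: lt_le_trans ampM.
move: (expR y) eY Z1 => z eY z1.
apply: (@le_lt_trans _ _ (2 * y * (2 * y * z))); last by nra.
apply: ler_pM => //.
  by rewrite addr_ge0 ?mulr_ge0//; lra.
by nra.
Qed.

Lemma fstepE (i : idx) (y : R) : fstep i y = y + (-1) ^+ (~~ i.2) * amp i.1.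
Proof. by rewrite /fstep /amp; case: i.2; rewrite /= ?expr0 ?expr1 ?mulN1r ?mul1r. Qed.

(** The exact maps are translations, so earlier errors are carried along without growth and each
    step adds at most [C]. *)
Lemma Fiter_near_sum (ft : idx -> R -> R) (C : R) (xs : nat -> idx) (n : nat) (x : R) :
  (forall i y, `|ft i y - fstep i y| <= C) ->
  `|Fiter ft xs n x - (x + \sum_(i < n) (-1) ^+ (~~ (xs i).2) * amp (xs i).1)|
  <= n%:R * C.
Proof.
move=> ftC; elim: n => [|n IHn] /=; first by rewrite big_ord0 addr0 subrr normr0 mul0r.
rewrite big_ord_recr/= -natr1 mulrDl mul1r.
have := ftC (xs n) (Fiter ft xs n x); rewrite fstepE => Cn.
apply: le_trans (lerD IHn Cn); apply: le_trans (ler_normD _ _).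
by rewrite le_eqVlt; apply/orP; left; apply/eqP; congr `| _ |; ring.
Qed.

(** A single [D] bounds the perturbation, the starting point and the target interval. The dominating
    level is the largest [M] with nonzero net count, not [m] itself. *)
Lemma Fiter_escape (ft : idx -> R -> R) (D : R) (xs : nat -> idx) (s n m : nat) (x : R) :
  (forall i y, `|ft i y - fstep i y| <= D) -> `|x| <= D ->
  3 * D <= s%:R -> (24 <= s)%N -> (n < 2 ^ s.+1)%N ->
  (s <= m)%N -> level_sum xs n m != 0 ->
  D < `|Fiter ft xs n x|.
Proof.
move=> ftD xD Ds s24 ns sm Sm.
have D0 : 0 <= D by exact: le_trans xD.
(* [U] exceeds every level used in the first [n] steps, so a largest unbalanced level exists. *)
pose U := (\max_(i < n) (xs i).1).+1.
have xsU i : (i < n)%N -> ((xs i).1 < U)%N.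
  by move=> ni; rewrite ltnS (leq_bigmax (Ordinal ni)).
have ubS k : level_sum xs n k != 0 -> (k <= U)%N.
  apply: contraNT; rewrite -ltnNge => Uk; rewrite /level_sum big1// => i /eqP ik.
  by have := xsU i (ltn_ord i); rewrite ik ltnNge (ltnW Uk).
have exS : exists k, level_sum xs n k != 0 by exists m.
case: (ex_maxnP exS ubS) => M SM maxM.
have sM : (s <= M)%N by exact: leq_trans (maxM _ Sm).
have MU : (M < U)%N.
  rewrite ltnNge; apply: contraNN SM => UM; rewrite /level_sum big1// => i /eqP ik.
  by have := xsU i (ltn_ord i); rewrite ik ltnNge UM.
have nM : n%:R <= 2 ^+ M.+1 :> R.
  rewrite -natrX ler_nat; apply: leq_trans (ltnW ns) _.
  by rewrite leq_exp2l.
have := Fiter_near_sum ft D xs n x ftD.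
rewrite (sum_steps_by_level xs n U xsU).
rewrite (big_cat_nat _ (n := M))//= ?(ltnW MU)// (big_ltn MU).
rewrite [X in _ + (_ + X)]big_nat [X in _ + (_ + X)]big1 ?addr0; last first.
  move=> k /andP[Mk _]; have [->|/maxM] := eqVneq (level_sum xs n k) 0.
    by rewrite mulr0.
  by rewrite leqNgt Mk.
set low := \sum_(0 <= _ < M) _; set F := Fiter _ _ _ _ => FD.
have lowB : `|low| <= n%:R * (M%:R * amp M.-1).
  apply: le_trans (ler_norm_sum _ _ _) _.
  rewrite [leRHS]mulrCA -[M in M%:R * _]subn0 mulr_natl -sumr_const_nat.
  rewrite big_nat [leRHS]big_nat; apply: ler_sum => k /andP[_ kM].
  rewrite normrM mulrC; apply: ler_pM => //.
    by rewrite -intr_norm -[n%:R]/((n%:Z)%:~R) ler_int norm_level_sum_le.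
  rewrite ger0_norm ?(le_trans ler01) ?amp_ge1// amp_homo//.
  by case: (M) kM.
have topB : amp M <= `|amp M * (level_sum xs n M)%:~R|.
  rewrite normrM ger0_norm ?(le_trans ler01 (amp_ge1 _))//.
  rewrite ler_peMr ?(le_trans ler01 (amp_ge1 _))// -intr_norm ler1z.
  by move: SM; lia.
have := amp_dominates D M D0 (le_trans Ds _) (leq_trans s24 sM).
rewrite ler_nat => /(_ sM) domM.
set top := _ * _ in FD topB.
have triangle : `|top| <= `|F| + `|x| + `|low| + `|F - (x + (low + top))|.
  rewrite [top in leLHS](_ : _ = F - x - low - (F - (x + (low + top)))); last by ring.
  by do 3![apply: le_trans (ler_normB _ _) _; rewrite ?lerD2r].
(* Lower levels, accumulated errors, and one [D] each for the start and the target; both [n] and 1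
   are at most [2 ^+ M.+1]. *)
have bound : n%:R * (M%:R * amp M.-1) + n%:R * D + 2 * D < amp M.
  apply: le_lt_trans domM.
  have p0 : 0 <= M%:R * amp M.-1 by rewrite mulr_ge0// (le_trans ler01) ?amp_ge1.
  have p1 : 1 <= 2 ^+ M.+1 :> R by rewrite exprn_ege1// ler1n.
  move: nM p1 p0; move: (M%:R * _) (2 ^+ _) (n%:R) => u v w; nra.
lra.
Qed.
End Levels.

(** * Parity probabilities for words over a finite alphabet *)

Section Parity.
Context {R : realType} {I J : finType} (q : I -> R) (lev : I -> option J).

(** Letters that [lev] sends to [None] lie outside the window and are unconstrained. *)
Definition all_even n (v : {ffun 'I_n -> I}) : bool :=
  [forall j : J, ~~ odd (\sum_(i < n) (lev (v i) == Some j))].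

(* Character sum: [(1 + (-1)^N) / 2] is the indicator of [N] even. *)
Lemma all_evenE n (v : {ffun 'I_n -> I}) :
  (all_even n v)%:R = 2^-1 ^+ #|J| *
    \sum_(e : {ffun J -> bool}) \prod_(i < n) \prod_(j : J)
      (-1) ^+ (e j && (lev (v i) == Some j)) :> R.
Proof.
under eq_bigr do rewrite exchange_big/=.
rewrite -(bigA_distr_bigA (fun j b => \prod_(i < n) (-1) ^+ (b && (lev (v i) == Some j))))/=.
rewrite -prodr_const -big_split/=.
under eq_bigr => j _.
  rewrite big_bool/= [X in _ + X]big1 ?expr0//.
  rewrite -[X in X + _](big_morph _ (exprD _) (expr0 (-1 : R))).
  rewrite -signr_odd.
  rewrite (_ : _ * _ = (~~ odd (\sum_(i < n) (lev (v i) == Some j)))%:R); last first.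
    by case: odd; rewrite /= ?expr1 ?expr0; lra.
  over.
rewrite /all_even; case: forallP => [ev|/forallP].
  by rewrite big1// => j _; rewrite ev.
rewrite negb_forall => /existsP[j nev].
by rewrite (bigD1 j)//= (negbTE nev) mul0r.
Qed.

(** Each character is a product over the [n] coordinates, so its sum over all words is an [n]-th
    power. *)
Lemma sum_all_even n :
  \sum_(v : {ffun 'I_n -> I} | all_even n v) \prod_(i < n) q (v i)
  = 2^-1 ^+ #|J| * \sum_(e : {ffun J -> bool})
      (\sum_(o : I) q o * \prod_(j : J) (-1) ^+ (e j && (lev o == Some j))) ^+ n.
Proof.
rewrite big_mkcond/=.
under eq_bigr => v _.
  rewrite (_ : (if _ then _ else _) = (all_even n v)%:R * \prod_(i < n) q (v i)); last first.
    by case: ifP; rewrite ?mul1r ?mul0r.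
  rewrite all_evenE -mulrA mulr_suml.
  under eq_bigr do rewrite -big_split/=.
  over.
rewrite -mulr_sumr exchange_big/=; congr *%R; apply: eq_bigr => e _.
rewrite -[in RHS](card_ord n) -prodr_const.
rewrite (bigA_distr_bigA (fun _ o => q o * \prod_(j : J) (-1) ^+ (e j && (lev o == Some j)))).
by apply: eq_bigr => v _; apply: eq_bigr => i _; rewrite mulrC.
Qed.

(** A letter has at most one level, so its sign is -1 exactly when [e] selects that level. *)
Lemma signed_weightE (e : J -> bool) :
  \sum_(o : I) q o * \prod_(j : J) (-1) ^+ (e j && (lev o == Some j))
  = \sum_(o : I) q o - 2 * \sum_(j | e j) \sum_(o | lev o == Some j) q o.
Proof.
have -> : \sum_(j | e j) \sum_(o | lev o == Some j) q o =
    \sum_(o : I) q o * \sum_(j | e j) (lev o == Some j)%:R.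
  under [RHS]eq_bigr do rewrite mulr_sumr.
  rewrite exchange_big/=; apply: eq_bigr => j _; rewrite big_mkcond/=.
  by apply: eq_bigr => o _; case: eqP; rewrite ?mulr1 ?mulr0.
rewrite mulr_sumr -sumrB; apply: eq_bigr => o _.
rewrite -[X in X - _]mulr1 mulrCA -mulrBr; congr *%R.
case: (lev o) => [j0|]; last by rewrite !big1 ?mulr0 ?subr0// => j _; rewrite andbF.
rewrite (bigD1 j0)//= [X in _ * X]big1 ?mulr1; last first.
  by move=> j /negbTE jj0; rewrite (_ : Some _ == _ = (j0 == j))// eq_sym jj0 andbF.
rewrite eqxx andbT big_mkcond (bigD1 j0)//= [X in _ * (_ + X)]big1 ?addr0; last first.
  by move=> j /negbTE jj0; rewrite (_ : Some _ == _ = (j0 == j))// eq_sym jj0 if_same.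
by rewrite eqxx; case: (e j0); rewrite /= ?expr1 ?expr0; lra.
Qed.

(** As the window has mass at most 1/2, each base 1 - 2w is nonnegative, and 1 - 2w <= exp(-2w)
    survives the [n]-th power. With w bounded below by [r] per selected level, the sum over [e]
    factors back into one factor per level. *)
Lemma sum_all_even_le n (r : R) :
  \sum_o q o = 1 ->
  (forall j, r <= \sum_(o | lev o == Some j) q o) -> 0 <= r ->
  \sum_j \sum_(o | lev o == Some j) q o <= 2^-1 ->
  \sum_(v : {ffun 'I_n -> I} | all_even n v) \prod_(i < n) q (v i)
  <= ((1 + expR (- (2 * r * n%:R))) / 2) ^+ #|J|.
Proof.
move=> q1 rj r0 sumr; rewrite sum_all_even mulrC exprMn ler_wpM2r ?exprn_ge0//.
rewrite -[leRHS]prodr_const.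
under [leRHS]eq_bigr => j _.
  rewrite (_ : 1 + _ = \sum_(b : bool) expR (- (2 * r * n%:R)) ^+ b); last first.
    by rewrite big_bool/= expr0 expr1 addrC.
  over.
rewrite (bigA_distr_bigA (fun _ b => expR (- (2 * r * n%:R)) ^+ (b : bool)))/=.
apply: ler_sum => e _; rewrite signed_weightE q1.
set w := \sum_(j | e j) _.
have rw : \sum_(j | e j) r <= w by apply: ler_sum.
have w12 : w <= 2^-1.
  apply: le_trans sumr; rewrite [leRHS](bigID (fun j => e j))/= lerDl.
  by apply: sumr_ge0 => j _; exact: le_trans (rj j).
have -> : \prod_(j : J) expR (- (2 * r * n%:R)) ^+ e j
    = expR (- (2 * \sum_(j | e j) r)) ^+ n.
  rewrite -expRM_natr mulr_sumr mulNr mulr_suml -sumrN expR_sum [RHS]big_mkcond/=.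
  by apply: eq_bigr => j _; case: (e j); rewrite ?expr1 ?expr0.
apply: lerXn2r; rewrite ?nnegrE ?expR_ge0//; first by lra.
by apply: le_trans (expR_ge1Dx _); lra.
Qed.
End Parity.

(** * Events of the i.i.d. sequence seen through a finite alphabet *)

Lemma measure_bigcup_finType {d : measure_display} {T : measurableType d}
    {R : realType} (P : {measure set T -> \bar R}) (X : finType) (D : pred X)
    (B : X -> set T) :
  (forall x, measurable (B x)) -> trivIset setT B ->
  P (\bigcup_(x in [set x | D x]) B x) = (\sum_(x | D x) P (B x))%E.
Proof.
move=> mB tB; pose r := [seq x <- enum X | D x].
have Dr : [set x | D x] = [set` r].
  by apply/seteqP; split => x /=; rewrite mem_filter mem_enum andbT.
rewrite Dr measure_fin_bigcup//; last by apply: sub_trivIset tB.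
have ur : uniq r by rewrite filter_uniq// enum_uniq.
by rewrite -(fsbig_seq _ _ ur)/= big_filter big_enum_cond.
Qed.

Lemma big_option_type {R : nmodType} {X : finType} (F : option X -> R) :
  \sum_(o : option X) F o = F None + \sum_(x : X) F (Some x).
Proof.
rewrite (bigD1 None)//=; congr +%R.
rewrite (reindex_omap Some id)/=; last by case.
by apply: eq_bigl => x; rewrite eqxx.
Qed.

Section Cylinders.
Context {R : realType} {d : measure_display} {T : measurableType d}
  (P : probability T R) (xi : nat -> T -> idx) (xi_iid : iid_law P xi).
Context {X : finType} (dec : X -> idx) (dec_inj : injective dec).

(** Collapses all indices outside the range of [dec] to [None], making the alphabet finite. *)
Definition enc (a : idx) : option X := [pick x | dec x == a].

(** [None] receives the leftover mass, so the total is 1 by construction. *)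
Definition enc_law (o : option X) : R :=
  if o is Some x then pk R (dec x) else 1 - \sum_x pk R (dec x).

Lemma sum_enc_law : \sum_o enc_law o = 1.
Proof. by rewrite big_option_type/= subrK. Qed.

Lemma encP (a : idx) (x : X) : (enc a == Some x) = (a == dec x).
Proof.
rewrite /enc; case: pickP => [y /eqP <-|/(_ x)] /=; last by rewrite eq_sym => ->.
by rewrite (inj_eq dec_inj) -(inj_eq Some_inj).
Qed.

(* A coordinate outside the range of [dec] is removed by taking the
   difference with the finitely many cylinders where it lies in that range. *)
Lemma enc_cylinder (s : seq nat) (v : nat -> option X) : uniq s ->
  measurable [set w | all (fun n => enc (xi n w) == v n) s] /\
  P [set w | all (fun n => enc (xi n w) == v n) s]
  = (\prod_(n <- s) enc_law (v n))%:E.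
Proof.
(* Induction on the number of [None] entries; both [s'] and [vx x] below have one fewer. *)
have [k] := ubnP (count (fun n => v n == None) s).
elim: k s v => // k IHk s v /ltnSE ck us.
have [/hasP[i si /eqP vi]|] := boolP (has (fun n => v n == None) s); last first.
  rewrite -all_predC => /allP vS.
  (* The default pair is never read on [s], where no entry is [None]. *)
  pose v' n := if v n is Some x then dec x else (0%N, true).
  have E n w : n \in s -> (enc (xi n w) == v n) = (xi n w == v' n).
    by move=> /vS; rewrite /v' /=; case: (v n) => // x _; rewrite encP.
  have -> : [set w | all (fun n => enc (xi n w) == v n) s]
      = [set w | all (fun n => xi n w == v' n) s].
    by apply/funext => w /=; rewrite (eq_in_all (fun n => E n w)).
  have [mA ->] := xi_iid s v' us; split => //; congr EFin.
  rewrite big_seq [RHS]big_seq; apply: eq_bigr => n /vS.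
  by rewrite /v' /=; case: (v n).
have prm := perm_to_rem si.
pose s' := rem i s.
have us' : uniq s' by rewrite rem_uniq.
have si' : i \notin s' by rewrite mem_rem_uniqF.
pose vx x n := if n == i then Some x else v n.
have cs' : (count (fun n => v n == None) s' < k)%N.
  by apply: leq_trans ck; rewrite (permP prm)/= vi eqxx.
have E x : {in s', vx x =1 v}.
  by move=> n ns'; rewrite /vx; case: eqP => // ni; rewrite -ni ns' in si'.
have csx x : (count (fun n => vx x n == None) s < k)%N.
  apply: leq_ltn_trans cs'; rewrite (permP prm)/= {1}/vx eqxx/= add0n.
  by rewrite (eq_in_count (a2 := fun n => v n == None))// => n /(E x) ->.
pose A t u := [set w | all (fun n => enc (xi n w) == u n) t].
have [mA' PA'] := IHk s' v cs' us'.
have mB x := (IHk s (vx x) (csx x) us).1.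
have PB x := (IHk s (vx x) (csx x) us).2.
rewrite -/(A s' v) in mA' PA'; rewrite -/(A s v).
have AB x : A s (vx x) = A s' v `&` [set w | enc (xi i w) == Some x].
  apply/seteqP; split => w; rewrite /A/= (perm_all _ prm)/= {1}/vx eqxx.
    move=> /andP[ix aw]; split => //; apply/allP => n ns'.
    by have /allP/(_ n ns') := aw; rewrite E.
  move=> [/allP aw ->] /=; apply/allP => n ns'; rewrite E//; exact: aw.
have As : A s v = A s' v `\` \bigcup_(x in [set x | xpredT x]) A s (vx x).
  have AsE w : A s v w = (enc (xi i w) == None) && all (fun n => enc (xi n w) == v n) s'.
    by rewrite /A/= (perm_all _ prm)/= vi.
  apply/seteqP; split => w; rewrite AsE.
    move=> /andP[/eqP iN aw]; split => // -[x _]; rewrite AB => -[_] /=.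
    by rewrite iN.
  move=> [aw nB]; rewrite andbC; apply/andP; split => //.
  case Ei: (enc (xi i w)) => [x|//]; exfalso; apply: nB; exists x => //.
  by rewrite AB; split => //=; rewrite Ei.
have tB : trivIset setT (fun x => A s (vx x)).
  move=> x y _ _ [w []]; rewrite !AB => -[_ /= /eqP ->] [_ /= /eqP].
  by case.
have mU : measurable (\bigcup_(x in [set x | xpredT x]) A s (vx x)).
  by apply: fin_bigcup_measurable => // x _; exact: mB.
rewrite As; split; first exact: measurableD.
have -> : P (A s' v `\` \bigcup_(x in [set x | xpredT x]) A s (vx x)) =
    (P (A s' v) - P (A s' v `&` \bigcup_(x in [set x | xpredT x]) A s (vx x)))%E.
  by apply: measureD => //; exact: le_lt_trans (probability_le1 P mA') (ltry 1).
rewrite setIidr; last by move=> w [x _]; rewrite AB => -[].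
rewrite measure_bigcup_finType// PA'.
have -> : (\sum_(x : X) P (A s (vx x)))%E
    = (\sum_(x : X) pk R (dec x) * \prod_(n <- s') enc_law (v n))%:E.
  rewrite -sumEFin; apply: eq_bigr => x _; rewrite PB; congr EFin.
  rewrite (perm_big _ prm)/= big_cons {1}/vx eqxx/=; congr *%R.
  by rewrite big_seq [RHS]big_seq; apply: eq_bigr => n /(E x) ->.
by rewrite -EFinB (perm_big _ prm)/= big_cons vi/= -mulr_suml mulrBl mul1r.
Qed.

Lemma measurable_enc n (v : {ffun 'I_n -> option X}) :
  measurable [set w | [ffun i : 'I_n => enc (xi i w)] = v] /\
  P [set w | [ffun i : 'I_n => enc (xi i w)] = v] = (\prod_(i < n) enc_law (v i))%:E.
Proof.
(* Extends the word to all of [nat]; only positions below [n] are read. *)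
pose v' k := if insub k is Some i then v i else None.
have v'E (i : 'I_n) : v' i = v i by rewrite /v' valK.
have -> : [set w | [ffun i : 'I_n => enc (xi i w)] = v]
    = [set w | all (fun k => enc (xi k w) == v' k) (index_iota 0 n)].
  apply/seteqP; split => w /=.
    move=> wv; apply/allP => k; rewrite mem_index_iota /= => kn.
    by rewrite /v' insubT -wv ffunE.
  move=> /allP aw; apply/ffunP => i; rewrite ffunE; apply/eqP.
  by rewrite -v'E; apply: aw; rewrite mem_index_iota/=.
have [mA ->] := enc_cylinder (index_iota 0 n) v' (iota_uniq _ _).
by split => //; rewrite big_mkord; under eq_bigr do rewrite v'E.
Qed.

(** Such an event is a finite disjoint union of single-word cylinders. *)
Lemma enc_event n (Q : pred {ffun 'I_n -> option X}) :
  measurable [set w | Q [ffun i : 'I_n => enc (xi i w)]] /\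
  P [set w | Q [ffun i : 'I_n => enc (xi i w)]]
  = (\sum_(v | Q v) \prod_(i < n) enc_law (v i))%:E.
Proof.
have -> : [set w | Q [ffun i : 'I_n => enc (xi i w)]]
    = \bigcup_(v in [set v | Q v]) [set w | [ffun i : 'I_n => enc (xi i w)] = v].
  apply/seteqP; split => w /=; first by exists [ffun i : 'I_n => enc (xi i w)].
  by move=> [v Qv /= ->].
split; first by apply: fin_bigcup_measurable => // v _; exact: (measurable_enc n v).1.
rewrite measure_bigcup_finType; first last.
- by move=> u v _ _ [w [/= <- <-]].
- by move=> v; exact: (measurable_enc n v).1.
by rewrite -sumEFin; apply: eq_bigr => v _; exact: (measurable_enc n v).2.
Qed.
End Cylinders.

(** * Even windows, dyadic blocks and Borel-Cantelli *)

(** The left side is the reciprocal of the smallest level probability in the window. The induction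
    starts at 3660 <= 4096; the inequality fails at 11. *)
Lemma sqr_le_expn2 s : (12 <= s)%N -> (5 * s * (5 * s).+1 <= 2 ^ s)%N.
Proof.
elim: s => // s IHs; rewrite leq_eqVlt => /predU1P[<-//|].
by rewrite ltnS => s12; have := IHs s12; rewrite expnS; nia.
Qed.

Section EvenWindow.
Context {R : realType} {d : measure_display} {T : measurableType d}
  (P : probability T R) (xi : nat -> T -> idx) (xi_iid : iid_law P xi).

Definition even_window (s n : nat) : set T :=
  [set w | forall m, (s <= m < 5 * s)%N ->
    ~~ odd (\sum_(i < n) ((xi i w).1 == m))].

Lemma sum_pk_sign (m : nat) :
  \sum_(b : bool) pk R (m, b) = m.+1%:R^-1 - m.+2%:R^-1.
Proof. by rewrite big_bool /pk/=; rewrite -mulrDl -div1r -splitr mul1r. Qed.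

Lemma even_window_prob (s n : nat) : (12 <= s)%N -> (2 ^ s <= n)%N ->
  measurable (even_window s n) /\ (P (even_window s n) <= ((2 / 3) ^+ (4 * s))%:E)%E.
Proof.
move=> s12 sn.
pose dec (x : 'I_(4 * s) * bool) : idx := ((s + x.1)%N, x.2).
have dec_inj : injective dec.
  by move=> [j b] [k c] [/addnI/val_inj -> ->].
pose lev (o : option ('I_(4 * s) * bool)) := omap fst o.
have levE a (j : 'I_(4 * s)) : (lev (enc dec a) == Some j) = (a.1 == s + j)%N.
  apply/idP/idP => [|/eqP aj].
    case Ea: (enc dec a) => [x|//]; rewrite /lev/= => /eqP[xj].
    by move/eqP: Ea; rewrite encP// => /eqP ->; rewrite /= xj.
  have /eqP -> : enc dec a == Some (j, a.2); last by rewrite /lev.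
  by rewrite encP// /dec/= -aj; case: (a).
have -> : even_window s n =
    [set w | all_even lev n [ffun i : 'I_n => enc dec (xi i w)]].
  apply/seteqP; split => w /=.
    move=> ev; apply/forallP => j.
    under eq_bigr do rewrite ffunE levE.
    by apply: ev; have := ltn_ord j; lia.
  move=> /forallP ev m sm; have ms : (m - s < 4 * s)%N by lia.
  have := ev (Ordinal ms); under eq_bigr do rewrite ffunE levE/=.
  by rewrite subnKC//; lia.
have [mE ->] := enc_event P xi xi_iid dec dec_inj n (all_even lev n).
split => //; rewrite lee_fin.
have levq (j : 'I_(4 * s)) : \sum_(o | lev o == Some j) enc_law dec o
    = (s + j).+1%:R^-1 - (s + j).+2%:R^-1 :> R.
  rewrite -sum_pk_sign big_mkcond big_option_type/= add0r.
  rewrite -(pair_bigA _ (fun k b => if Some k == Some j then pk R ((s + k)%N, b) else 0))/=.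
  rewrite (bigD1 j)//= eqxx [X in _ + X]big1 ?addr0// => k /negbTE kj.
  by rewrite big1// => b _; rewrite (_ : Some _ == _ = (k == j))// kj.
(* The probability of the last level of the window, 5s - 1. *)
pose r : R := ((5 * s) * (5 * s).+1)%:R^-1.
have r0 : 0 <= r by rewrite invr_ge0.
apply: le_trans (sum_all_even_le _ lev n r (sum_enc_law dec) _ r0 _) _.
- move=> j; rewrite levq.
  have -> : (s + j).+1%:R^-1 - (s + j).+2%:R^-1 = ((s + j).+1 * (s + j).+2)%:R^-1 :> R.
    have u0 : (s + j).+1%:R != 0 :> R by rewrite pnatr_eq0.
    have u1 : (s + j).+1%:R + 1 != 0 :> R by rewrite natr1 pnatr_eq0.
    rewrite natrM -[(s + j).+2%:R]natr1; move: u0 u1; move: (_.+1%:R) => u u0 u1.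
    by field; rewrite u0 u1.
  rewrite lef_pV2 ?posrE ?ltr0n ?muln_gt0//; last by lia.
  by rewrite ler_nat; apply: leq_mul; have := ltn_ord j; lia.
(* The window mass telescopes to 1/(s+1) - 1/(5s+1), which is below 1/2. *)
- under eq_bigr do rewrite levq.
  rewrite -(big_mkord xpredT (fun j => (s + j).+1%:R^-1 - (s + j).+2%:R^-1)).
  rewrite (telescope_sumr_eq (fun j => - (s + j).+1%:R^-1))//; last first.
    by move=> k _; rewrite addnS opprK addrC.
  rewrite addn0 opprK addrC.
  apply: (@le_trans _ _ s.+1%:R^-1); first by rewrite gerBl invr_ge0.
  by rewrite lef_pV2 ?posrE ?ltr0n// ler_nat; lia.
rewrite card_ord; apply: lerXn2r; rewrite ?nnegrE ?divr_ge0 ?addr_ge0 ?expR_ge0//.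
have rn : 1 <= r * n%:R.
  rewrite mulrC ler_pdivlMr ?ltr0n ?muln_gt0 ?mul1r ?ler_nat; last by lia.
  exact: leq_trans (sqr_le_expn2 s s12) sn.
(* From exp(t) >= 1 + t at t = 2rn >= 2; each factor is then at most (1 + 1/3)/2 = 2/3. *)
have e3 : expR (- (2 * r * n%:R)) <= 3^-1.
  rewrite expRN lef_pV2 ?posrE ?expR_gt0//.
  by apply: le_trans (expR_ge1Dx _); lra.
by lra.
Qed.

Definition even_block (s : nat) : set T :=
  \big[setU/set0]_(k < 2 ^ s) even_window s (2 ^ s + k).

Lemma measurable_even_block (s : nat) : (12 <= s)%N -> measurable (even_block s).
Proof.
move=> s12; apply: bigsetU_measurable => k _.
by apply: (even_window_prob s _ s12 _).1; rewrite leq_addr.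
Qed.

Lemma even_block_prob (s : nat) : (12 <= s)%N ->
  (P (even_block s) <= (2^-1 ^+ s)%:E)%E.
Proof.
move=> s12.
have le2 k : (2 ^ s <= 2 ^ s + k)%N by rewrite leq_addr.
have sub : (P (even_block s) <= \sum_(k < 2 ^ s) P (even_window s (2 ^ s + k)))%E.
  apply: (content_subadditive P (F := fun k => even_window s (2 ^ s + k))) => //.
    by move=> k _; exact: (even_window_prob s _ s12 (le2 k)).1.
  exact: measurable_even_block.
apply: le_trans sub _.
apply: (@le_trans _ _ (\sum_(k < 2 ^ s) ((2 / 3) ^+ (4 * s))%:E)%E).
  by apply: lee_sum => k _; exact: (even_window_prob s _ s12 (le2 k)).2.
(* A window of 4s levels gives the ratio 2 (2/3)^4 = 32/81 <= 1/2. *)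
rewrite sumEFin lee_fin sumr_const card_ord -[leLHS]mulr_natl natrX exprM -exprMn.
by apply: lerXn2r; rewrite ?nnegrE; lra.
Qed.

Lemma even_block_limsup0 : P (lim_sup_set (fun k => even_block (k + 12))) = 0%E.
Proof.
apply: lim_sup_set_cvg0 => [k|]; first by apply: measurable_even_block; lia.
apply: (@le_lt_trans _ _ (\sum_(0 <= k <oo) ((1 / (2 ^ (k + 12))%:R)%:E : \bar R))%E).
  apply: lee_nneseries => [k _ _|k _]; first exact: measure_ge0.
  apply: le_trans (even_block_prob _ _) _; first by lia.
  by rewrite lee_fin exprVn natrX mul1r.
(* The argument 11 corresponds to the exponents k + 12. *)
have /cvg_lim -> // := @cvg_geometric_eseries_half R 1 11.
by rewrite ltry.
Qed.

Lemma ae_eventually_not_even_block :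
  {ae P, forall w, exists s0, forall s, (s0 <= s)%N -> ~ even_block s w}.
Proof.
exists (lim_sup_set (fun k => even_block (k + 12))); split.
- apply: bigcap_measurable => // k _; apply: bigcup_measurable => j _.
  by apply: measurable_even_block; lia.
- exact: even_block_limsup0.
move=> w /= nw n _; apply: contrapT => nB; apply: nw.
exists (n + 12)%N => s ns Bs; apply: nB; exists (s - 12)%N => /=; first by lia.
by rewrite subnK//; lia.
Qed.
End EvenWindow.

(** * Almost sure finiteness of the return times *)

Lemma Fiter_transient {R : realType} {d : measure_display} {T : measurableType d}
    (P : probability T R) (xi : nat -> T -> idx) (x a b C : R) (ft : idx -> R -> R) :
  iid_law P xi -> (forall i y, `|ft i y - fstep i y| <= C) ->
  {ae P, forall w, finite_set [set n : nat |
     a <= Fiter ft (fun m => xi m w) n x <= b]}.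
Proof.
move=> xi_iid ftC.
apply: filterS (ae_eventually_not_even_block P xi xi_iid) => w [s0 nB].
pose D := `|C| + `|x| + `|a| + `|b|.
have [[[a0 b0] x0] C0] := (normr_ge0 a, normr_ge0 b, normr_ge0 x, normr_ge0 C).
(* Past [s1] no block is even and both thresholds of [Fiter_escape] are met, so returns can only
   occur before [2 ^ s1]. *)
pose s1 := maxn s0 (maxn 24 (Num.truncn (3 * D)).+1).
apply: (@sub_finite_set _ _ `I_(2 ^ s1)); last exact: finite_II.
move=> n /= Fab.
rewrite ltnNge; apply/negP => s1n.
have n0 : (0 < n)%N by apply: leq_trans s1n; rewrite expn_gt0.
have /andP[sn ns] := trunc_log_bounds (isT : (1 < 2)%N) n0.
set s := trunc_log 2 n in sn ns.
have s1s : (s1 <= s)%N by exact: trunc_log_max.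
have [s0s s24 sD] : [/\ (s0 <= s)%N, (24 <= s)%N & 3 * D <= s%:R].
  move: s1s; rewrite !geq_max => /and3P[-> -> sD]; split => //.
  by apply: le_trans (ltW (truncnS_gt _)) _; rewrite ler_nat.
have : ~ even_window xi s n w.
  apply: contra_not (nB _ s0s) => Ew.
  (* The offset of [n] inside its dyadic block. *)
  have kn : (n - 2 ^ s < 2 ^ s)%N by move: ns; rewrite expnS; lia.
  rewrite /even_block (bigD1 (Ordinal kn))//=; left.
  by rewrite subnKC.
(* Some level [m >= s] has an odd count, hence a nonzero net count, which forces escape. *)
move=> /existsNP[m /not_implyP[/andP[sm _] /negP]]; rewrite negbK => oddm.
have := Fiter_escape ft D (fun m => xi m w) s n m x _ _ sD s24 ns sm
  (odd_level_sum_neq0 (fun i => xi i w) n m oddm).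
have CD : C <= D by have := ler_norm C; rewrite /D; lra.
move=> /(_ (fun i y => le_trans (ftC i y) CD)) FD.
have /FD : `|x| <= D by rewrite /D; lra.
apply/negP; rewrite -leNgt.
move: Fab; set F := Fiter _ _ _ _ => /andP[aF Fb].
have := ler_norm b; have := ler_norm (- a); rewrite normrN => aa bb.
by rewrite /D ler_norml; apply/andP; split; lra.
Qed.

Theorem theorem5 (R : realType) (d : measure_display) (T : measurableType d)
  (P : probability T R) (xi : nat -> T -> idx) :
  iid_law P xi ->
  forall x a b : R,
    {ae P, forall w, finite_set [set n : nat |
        a <= Fiter (@fstep R) (fun m => xi m w) n x <= b]} /\
    (forall ft : idx -> R -> R,
       (exists C : R, forall (i : idx) (y : R), `|ft i y - fstep i y| <= C) ->
       {ae P, forall w, finite_set [set n : nat |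
          a <= Fiter ft (fun m => xi m w) n x <= b]}).
Proof.
move=> xi_iid x a b; split => [|ft [C ftC]].
  by apply: (Fiter_transient P xi x a b 0) => // i y; rewrite subrr normr0.
exact: (Fiter_transient P xi x a b C).
Qed.
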